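(* Let $\mathrm{ord}(\ell)>3$, and let $\mathcal{F}$ be the folded component (the graph specified in the context). Suppose the new edge $\mathcal{E}$, which joins two distinct floor vertices, has both endpoints in $\mathcal{F}$, and write $\mathcal{E}=\{2m,2(m+k)\}$ with $m,k\in\mathbb{Z}$, $1\le m\le\frac12(\mathrm{ord}(\ell)-3)$ and $1\le k\le\frac12(\mathrm{ord}(\ell)-1)-m$. Let $\mathcal{F}+\mathcal{E}$ be the graph obtained from $\mathcal{F}$ by adding the edge $\mathcal{E}$. Then the value of $\mathrm{diam}(\mathcal{F}+\mathcal{E})$ is: 1. $\max\left[\frac12(\mathrm{ord}(\ell)-2k+7),\ \left\lceil\frac k2\right\rceil+\frac12(\mathrm{ord}(\ell)-2(m+k)+5),\ m+\left\lceil\frac k2\right\rceil+2\right]$ if $k\ge4$; 2. $\frac12(\mathrm{ord}(\ell)-1)$ if $k\in\{2,3\}$ and $2(m+k)=\mathrm{ord}(\ell)-1$; 3. $\frac12(\mathrm{ord}(\ell)+1)$ otherwise.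
   Context: Let $p$ be a prime with $p\equiv 71$ or $119\pmod{120}$, let $\ell=2$, and let $\mathrm{ord}(\ell)$ be the order, in the ideal class group of $\mathbb{Q}(\sqrt{-p})$, of a prime ideal above $2$; it is an odd integer $\ge 3$. The folded component $\mathcal{F}$ (a component of the supersingular $2$-isogeny graph over $\mathbb{F}_p$ after identifying curves up to $\overline{\mathbb{F}_p}$-isomorphism, regarded as a simple undirected graph) is labelled so that $V(\mathcal{F})=\{0,1,\dots,\mathrm{ord}(\ell)-1\}$ and $$E(\mathcal{F})=\{\{2k-1,2k+1\}: 1\le k\le \tfrac12(\mathrm{ord}(\ell)-3)\}\cup\{\{2k+1,2k+2\}:0\le k\le \tfrac12(\mathrm{ord}(\ell)-3)\}\cup\{\{0,1\}\}.$$ The floor vertices of $\mathcal{F}$ are the nonzero even vertices. The new edge $\mathcal{E}$ is the single edge coming from $2$-isogenies not defined over $\mathbb{F}_p$ that must be added to obtain the spine; its endpoints are always two distinct floor vertices, and here it is treated as an arbitrary edge joining two distinct floor vertices of $\mathcal{F}$. The diameter is the maximum graph distance between two vertices. *)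

(* Defs.v *)
From mathcomp Require Import all_boot all_order all_algebra all_field.

Set Implicit Arguments.
Unset Strict Implicit.
Unset Printing Implicit Defensive.

Import Order.TTheory GRing.Theory Num.Theory.

Section ImaginaryQuadratic.
Local Open Scope ring_scope.

(* The ring of integers of Q(sqrt(-p)), as a subset of algC. *)
Definition quad_int (p : nat) (z : algC) : Prop :=
  z \in Aint /\ exists a b : rat, z = ratr a + ratr b * sqrtC (- p%:R).

Definition is_ideal (p : nat) (I : algC -> Prop) : Prop :=
  [/\ forall x, I x -> quad_int p x,
      I 0,
      forall x y, I x -> I y -> I (x + y)
    & forall a x, quad_int p a -> I x -> I (a * x)].

Definition is_prime_ideal (p : nat) (I : algC -> Prop) : Prop :=
  [/\ is_ideal p I, ~ I 1
    & forall x y, quad_int p x -> quad_int p y -> I (x * y) -> I x \/ I y].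

Definition ideal_mul (I J : algC -> Prop) (z : algC) : Prop :=
  exists2 s : seq (algC * algC),
    (forall u, u \in s -> I u.1 /\ J u.2) & z = \sum_(u <- s) u.1 * u.2.

Fixpoint ideal_exp (p : nat) (I : algC -> Prop) (d : nat) : algC -> Prop :=
  if d is d'.+1 then ideal_mul I (ideal_exp p I d') else quad_int p.

(* I and J have the same class: a I = b J for some nonzero integers a, b. *)
Definition same_ideal_class (p : nat) (I J : algC -> Prop) : Prop :=
  exists a b : algC, [/\ quad_int p a, quad_int p b, a != 0, b != 0
    & forall z, (exists2 x, I x & z = a * x) <-> (exists2 y, J y & z = b * y)].

(* The trivial class is that of the whole ring, quad_int p. *)
Definition is_class_order (p : nat) (I : algC -> Prop) (d : nat) : Prop :=
  [/\ (0 < d)%N, same_ideal_class p (ideal_exp p I d) (quad_int p)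
    & forall e, (0 < e)%N -> same_ideal_class p (ideal_exp p I e) (quad_int p) ->
        (d <= e)%N].

End ImaginaryQuadratic.

(* A simple graph on a finite type T is given by its set of edges; only the   *)
(* two-element members of this set matter.                                    *)
Definition adj (T : finType) (G : {set {set T}}) : rel T :=
  fun x y => (x != y) && ([set x; y] \in G).

Definition add_edge (T : finType) (G : {set {set T}}) (e : {set T}) :
  {set {set T}} := e |: G.

Definition is_walk (T : finType) (G : {set {set T}}) (x y : T) (s : seq T) :=
  path (adj G) x s /\ last x s = y.

Definition is_dist (T : finType) (G : {set {set T}}) (x y : T) (d : nat) : Prop :=
  (exists2 s, is_walk G x y s & size s = d) /\
  (forall s, is_walk G x y s -> d <= size s).

(* In particular G is connected, since every distance has to exist. *)
Definition is_diameter (T : finType) (G : {set {set T}}) (D : nat) : Prop :=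
  (exists x y, is_dist G x y D) /\
  (forall x y, exists2 d, is_dist G x y d & d <= D).

(* The pair {a, b} of vertices of {0, ..., n-1}, named by natural numbers. *)
Definition edge (n a b : nat) : {set 'I_n} :=
  [set x : 'I_n | (val x == a) || (val x == b)].

(* Here n = ord(l) is odd and at least 3, so the halves are exact; letting k  *)
(* range over 'I_n loses nothing as (n - 3) / 2 < n.                          *)
Definition folded (n : nat) : {set {set 'I_n}} :=
  [set edge n (2 * k - 1) (2 * k + 1) | k : 'I_n & 1 <= k <= (n - 3)./2]
  :|: [set edge n (2 * k + 1) (2 * k + 2) | k : 'I_n & 0 <= k <= (n - 3)./2]
  :|: [set edge n 0 1].

Definition floor_vertex (n : nat) (x : 'I_n) : bool := (val x != 0) && ~~ odd (val x).

(* Main.v *)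
Require Import Defs.
From mathcomp Require Import all_boot all_order all_algebra all_field.
From mathcomp Require Import zify ring.

(* The arithmetic input is that n is odd; for even n the graph would not even be
   connected.  Suppose n = 2e, and let g generate P^(2e); then
   g = (A + B sqrt(-p)) / 2 has norm 4^e and is not divisible by 2, so A and B
   are odd.  The factors of p B^2 = (2^(e+1) - A) (2^(e+1) + A) are coprime,
   hence one is p r^2 and the other is s^2, and b = (s + r sqrt(-p)) / 2
   satisfies b^2 = g or b^2 = -g up to the sign of r.  Since the ring of
   integers is integrally closed, P^e is contained in (b); comparing norms gives
   P^e = (b), against the minimality of n.

   In the graph, every vertex is on the spine 1, 3, 5, ... or hangs from it, so
   tree distances are explicit, and a distance after adding an edge {a, b} is the
   least of three: avoiding the edge, crossing it from a to b, or from b to a.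
   The diameter is attained at 0 or the last floor vertex together with either
   the other one or a floor vertex on the new cycle. *)

Set Implicit Arguments.
Unset Strict Implicit.
Unset Printing Implicit Defensive.

Import Order.TTheory GRing.Theory Num.Theory.

(** * The order of the prime above 2 is odd *)

Lemma coprime_mul_sqr (u v b : nat) : coprime u v -> u * v = b ^ 2 ->
  exists r s, [/\ u = r ^ 2, v = s ^ 2 & b = r * s].
Proof.
(* [gcdn x b ^ 2] is the gcd of [x * x], [x * b] and [b ^ 2 = x * y], hence [x] times the gcd of
   [x], [b] and [y], which is 1. *)
have sqr_gcd (x y : nat) : coprime x y -> x * y = b ^ 2 -> x = gcdn x b ^ 2.
  move=> cxy xyb; rewrite [in RHS]expnS expn1 muln_gcdl !muln_gcdr (mulnC b x).
  rewrite gcdnA -(gcdnA (x * x)) gcdnn -gcdnA -[b * b]/(b ^ 2) -xyb.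
  rewrite -!muln_gcdr [gcdn b y]gcdnC gcdnA.
  by rewrite (eqP cxy) gcd1n muln1.
move=> cuv uvb; exists (gcdn u b), (gcdn v b).
have uE := sqr_gcd u v cuv uvb.
have vE : v = gcdn v b ^ 2 by apply: (sqr_gcd v u); rewrite 1?coprime_sym 1?mulnC.
by split=> //; apply/eqP; rewrite -(eqn_exp2r _ _ (_ : 0 < 2)) // expnMn -uE -vE uvb.
Qed.

Lemma coprime_mul_prime_sqr (p u v b : nat) : prime p -> coprime u v -> u * v = p * b ^ 2 ->
  exists r s, b = r * s /\ (u = p * r ^ 2 /\ v = s ^ 2 \/ u = s ^ 2 /\ v = p * r ^ 2).
Proof.
move=> p_prime; wlog : u v / p %| u.
  move=> W cuv uvb; have : p %| u * v by rewrite uvb dvdn_mulr.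
  rewrite Euclid_dvdM // => /orP[pu|pv]; first exact: W.
  rewrite coprime_sym in cuv; rewrite mulnC in uvb.
  by have [r [s [bE uvE]]] := W v u pv cuv uvb; exists r, s; split=> //; tauto.
case/dvdnP=> w -> cuv uvb; have p_gt0 := prime_gt0 p_prime.
have wv : w * v = b ^ 2.
  by apply/eqP; rewrite -(eqn_pmul2l p_gt0) -uvb mulnA (mulnC p).
have cwv : coprime w v by move: cuv; rewrite coprimeMl => /andP[].
have [r [s [-> -> ->]]] := coprime_mul_sqr cwv wv.
by exists r, s; split=> //; left; rewrite mulnC.
Qed.

Section OddClassOrder.
Local Open Scope ring_scope.

(** The two equations together say that [(s + r sqrt(-p))^2] equals [2 (a + b sqrt(-p))] up to the
    sign [(-1) ^+ i]. *)
Lemma sum_sqr_prime_sqr (p e : nat) (a b : int) :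
    prime p -> odd `|a|%N -> b != 0 ->
    a ^+ 2 + p%:Z * b ^+ 2 = (2 ^+ e.+1) ^+ 2 ->
  exists r s (i : bool),
    s ^+ 2 - p%:Z * r ^+ 2 = (-1) ^+ i * (2 * a) /\ s * r = (-1) ^+ i * b.
Proof.
move=> p_prime a_odd b_neq0 abE; have p_gt0 := prime_gt0 p_prime.
have b2_gt0 : 0 < p%:Z * b ^+ 2 by rewrite mulr_gt0 ?exprn_even_gt0 // ltz_nat.
have : `|a| < 2 ^+ e.+1 :> int.
  by rewrite -ltr_sqr ?nnegrE ?exprn_ge0 // real_normK ?num_real // -abE ltrDl.
rewrite ltr_norml => /andP[a_gt a_lt].
have [u uE] : exists u : nat, u%:Z = 2 ^+ e.+1 - a.
  by exists (absz (2 ^+ e.+1 - a)); rewrite gez0_abs // subr_ge0 ltW.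
have [v vE] : exists v : nat, v%:Z = 2 ^+ e.+1 + a.
  by exists (absz (2 ^+ e.+1 + a)); rewrite gez0_abs //; lia.
have uvb : (u * v = p * `|b| ^ 2)%N.
  apply/eqP; rewrite -eqz_nat !PoszM uE vE !abszE -normrM.
  rewrite -expr2 ger0_norm ?sqr_ge0 //; apply/eqP.
  have -> : p%:Z * b ^+ 2 = (2 ^+ e.+1) ^+ 2 - a ^+ 2 by rewrite -abE; ring.
  ring.
have cuv : coprime u v.
  have uv2 : (u + v = 2 ^ e.+2)%N.
    have pow2 : (2 ^ e.+1)%N%:Z = 2 ^+ e.+1 by rewrite -[LHS]natz natrX.
    apply/eqP; rewrite -eqz_nat PoszD uE vE (expnS 2) PoszM pow2; apply/eqP; ring.
  have u_odd : odd u by move: uE; rewrite exprS; move: (2 ^+ e) => t; lia.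
  by rewrite /coprime -(gcdnDl u v) uv2 -/(coprime _ _) coprimeXr // coprimen2.
have [r [s [bE uvE]]] := coprime_mul_prime_sqr p_prime cuv uvb.
have absb : `|b| = (r%:Z * s%:Z) :> int by rewrite -abszE bE.
have sgb2 : Num.sg b ^+ 2 = 1 by rewrite sqr_sg b_neq0.
(* [i] records which of the factors [u] and [v] carries [p]. *)
have [i iE] : exists i : bool, s%:Z ^+ 2 - p%:Z * r%:Z ^+ 2 = (-1) ^+ i * (2 * a).
  have -> : 2 * a = v%:Z - u%:Z by rewrite uE vE; ring.
  by case: uvE => [] [-> ->]; [exists false | exists true]; rewrite !PoszM; ring.
(* The sign put on [r] adjusts the product and leaves [r ^+ 2] unchanged. *)
exists ((-1) ^+ i * Num.sg b * r%:Z), s%:Z, i; split.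
  by rewrite !exprMn sgb2 sqrr_sign !mul1r.
have -> : s%:Z * ((-1) ^+ i * Num.sg b * r%:Z) = (-1) ^+ i * (Num.sg b * (r%:Z * s%:Z)).
  ring.
by rewrite -absb -numEsg.
Qed.

Lemma Aint_sqr x : x ^+ 2 \in Aint -> x \in Aint.
Proof.
move=> Ax2; pose q := minCpoly (x ^+ 2) \Po 'X^2.
apply: (@root_monic_Aint q).
- by rewrite /root horner_comp hornerXn -/(root _ _) root_minCpoly.
- rewrite monicE lead_coef_comp ?size_polyXn // lead_coefXn expr1n mulr1.
  exact: minCpoly_monic.
- by rewrite polyOver_comp ?rpredX ?polyOverX.
Qed.

(** The squared denominator is coprime to the squared numerator, so it divides [p], and a prime is
    squarefree. *)
Lemma sqr_prime_rat_int (p : nat) (c : rat) :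
  prime p -> p%:R * c ^+ 2 \is a Num.int -> c \is a Num.int.
Proof.
move=> p_prime /intrP[m pcm].

have eq_p : p%:Z * numq c ^+ 2 = m * denq c ^+ 2.
  by apply: (@intr_inj rat); rewrite !expr2 !intrM -pcm numqE; ring.
have : (`|denq c| ^ 2 %| p)%N.
  have cop : coprime (`|denq c| ^ 2) (`|numq c| ^ 2).
    by rewrite coprimeXl // coprimeXr // coprime_sym coprime_num_den.
  rewrite -(Gauss_dvdl p cop); apply/dvdnP; exists `|m|%N.
  by have := congr1 absz eq_p; rewrite !expr2 !abszM.
rewrite Qint_def => d2p; have d_gt0 := denq_gt0 c.
have d_dvd : (`|denq c| %| p)%N by apply: dvdn_trans d2p; rewrite dvdn_exp.
have [p_gt1 p_div] := primeP p_prime.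
have /orP[/eqP d1|/eqP dp] := p_div _ d_dvd; first by apply/eqP; lia.
have := dvdn_leq (ltnW p_gt1) d2p; rewrite dp -{2}[p]expn1 leq_exp2l //.
Qed.

(** * Norms and an integral basis in the integers of Q(sqrt(-p)) *)

Section QuadraticIntegers.

Variable p : nat.
Hypothesis p_prime : prime p.
Hypothesis p_mod8 : (p %% 8 = 7)%N.
Local Notation s := (sqrtC (- p%:R) : algC).
Local Notation O := (quad_int p).

Lemma sqrt_sqr : s ^+ 2 = - p%:R.
Proof. exact: sqrtCK. Qed.

Lemma sqrt_conj : s^* = - s.
Proof.
have : (s^*) ^+ 2 == s ^+ 2 by rewrite -rmorphXn sqrt_sqr rmorphN rmorph_nat.
rewrite eqf_sqr => /orP[/eqP/CrealP s_real|/eqP//].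
have := real_exprn_even_ge0 s_real (isT : ~~ odd 2).
by rewrite sqrt_sqr oppr_ge0 lern0 => /eqP p0; have := prime_gt0 p_prime; rewrite p0.
Qed.

Lemma quad_int_int (a : int) : O a%:~R.
Proof.
split; first exact: Aint_int.
by exists a%:~R, 0; rewrite ratr_int rmorph0 mul0r addr0.
Qed.

Lemma quad_int1 : O 1. Proof. exact: quad_int_int 1. Qed.

Lemma quad_intD x y : O x -> O y -> O (x + y).
Proof.
move=> [Ax [a [b xE]]] [Ay [c [d yE]]]; split; first exact: rpredD.
by exists (a + c), (b + d); rewrite xE yE !rmorphD /=; ring.
Qed.

Lemma quad_intN x : O x -> O (- x).
Proof.
move=> [Ax [a [b xE]]]; split; first by rewrite rpredN.
by exists (- a), (- b); rewrite xE !rmorphN /=; ring.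
Qed.

Lemma quad_intM x y : O x -> O y -> O (x * y).
Proof.
move=> [Ax [a [b xE]]] [Ay [c [d yE]]]; split; first exact: rpredM.
exists (a * c - p%:R * (b * d)), (a * d + b * c); rewrite xE yE.
rewrite !(rmorphD, rmorphN, rmorphM) /= rmorph_nat.
apply/eqP; rewrite -subr_eq0; apply/eqP.
transitivity (ratr b * ratr d * (s ^+ 2 + p%:R)); first ring.
by rewrite sqrt_sqr addNr mulr0.
Qed.

Lemma conj_quad (a b : rat) : (ratr a + ratr b * s)^* = ratr a - ratr b * s.
Proof. by rewrite rmorphD [X in _ + X]rmorphM /= sqrt_conj !fmorph_rat mulrN. Qed.

Lemma quad_norm (a b : rat) :
  (ratr a + ratr b * s) * (ratr a + ratr b * s)^* = ratr (a ^+ 2 + p%:R * b ^+ 2).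
Proof.
rewrite conj_quad; transitivity (ratr a ^+ 2 - s ^+ 2 * ratr b ^+ 2 : algC); first ring.
rewrite sqrt_sqr mulNr opprK rmorphD (rmorphXn (@ratr algC)).
by rewrite (rmorphM (@ratr algC)) (rmorphXn (@ratr algC)) rmorph_nat.
Qed.

Lemma quad_int_conj x : O x -> O x^*.
Proof.
move=> [Ax [a [b xE]]]; split; first by rewrite Aint_aut.
by exists a, (- b); rewrite xE conj_quad rmorphN mulNr.
Qed.

Lemma quad_int_norm x : O x -> exists n : nat, x * x^* = n%:R.
Proof.
move=> Ox; have [Axx _] := quad_intM Ox (quad_int_conj Ox).
case: Ox Axx => _ [a [b xE]] Axx.
apply/natrP; rewrite natrEint; apply/andP; split; last exact: mul_conjC_ge0.
apply: Cint_rat_Aint => //; apply/CratP.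
by exists (a ^+ 2 + p%:R * b ^+ 2); rewrite xE quad_norm.
Qed.

(** Since [p] is odd, the norm form is congruent to [(a - b) ^+ 2] modulo 2. *)
Lemma dvd2_norm (a b : int) : (2 %| a ^+ 2 + p%:Z * b ^+ 2)%Z -> (2 %| a - b)%Z.
Proof.
have [q pE] : exists q, p = (2 * q + 1)%N by exists (p %/ 2)%N; lia.
move=> norm2; suff : (2 %| (a - b) ^+ 2)%Z.
  by rewrite !dvdzE expr2 abszM -[(_ * _)%N]/(_ ^ 2)%N Euclid_dvdX // => /andP[].
have -> : (a - b) ^+ 2 = a ^+ 2 + p%:Z * b ^+ 2 - 2 * (q%:Z * b ^+ 2 + a * b).
  rewrite pE PoszD PoszM; ring.
by rewrite rpredB ?dvdz_mulr.
Qed.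

(** The trace [A = 2 * a] is an integer, so [p (2 b)^2 = 4 n - A^2] is one as well, which forces
    [2 * b] to be an integer; the parity condition holds because [4 n] is even. *)
Lemma quad_intP x : O x -> exists a b : int,
  [/\ x = (a%:~R + b%:~R * s) / 2, (2 %| (a - b))%Z
    & x * x^* = (a ^+ 2 + p%:Z * b ^+ 2)%:~R / 4].
Proof.
move=> Ox; have [n nE] := quad_int_norm Ox; have [Axx _] := quad_intD Ox (quad_int_conj Ox).
case: Ox => _ [a [b xE]].
have xc : x^* = ratr a - ratr b * s.
  by rewrite xE conj_quad.
have a2_int : 2 * a \is a Num.int.
  rewrite -(Cint_rat (2 * a)); apply: Cint_rat_Aint; first by apply/CratP; exists (2 * a).
  by have <- : x + x^* = ratr (2 * a) by rewrite xc xE rmorphM rmorph_nat; ring.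
have n_eq : (a ^+ 2 + p%:R * b ^+ 2) = n%:R.
  by apply: (@fmorph_inj _ _ (@ratr algC)); rewrite rmorph_nat -nE xE quad_norm.
have [A AE] := intrP a2_int.
have b2_int : 2 * b \is a Num.int.
  apply: (sqr_prime_rat_int p_prime).
  have -> : p%:R * (2 * b) ^+ 2 = (4 * n%:Z - A ^+ 2)%:~R.
    rewrite intrB intrM expr2 intrM -AE -[n%:Z%:~R]/(n%:R) -n_eq; ring.
  exact: intr_int.
have [B BE] := intrP b2_int.
have ABn : A ^+ 2 + p%:Z * B ^+ 2 = 4 * n%:Z.
  apply: (@intr_inj rat); rewrite intrD !expr2 !intrM -AE -BE.
  rewrite -[p%:Z%:~R]/(p%:R) -[n%:Z%:~R]/(n%:R) -n_eq; ring.
have ratrA : ratr a = A%:~R / 2 :> algC.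
  by rewrite -ratr_int -AE rmorphM rmorph_nat mulrC mulKf ?pnatr_eq0.
have ratrB : ratr b = B%:~R / 2 :> algC.
  by rewrite -ratr_int -BE rmorphM rmorph_nat mulrC mulKf ?pnatr_eq0.
exists A, B; split; first by rewrite xE ratrA ratrB; field.
- by apply: dvd2_norm; rewrite ABn dvdz_mulr.
by rewrite ABn nE intrM mulrC mulKf ?pnatr_eq0.
Qed.

Definition quad_half (i : bool) : algC := (1 + (-1) ^+ i * s) / 2.

Lemma quad_half_conj i : (quad_half i)^* = 1 - quad_half i.
Proof.
rewrite /quad_half rmorphM rmorphD rmorphM /= sqrt_conj rmorph1 rmorph_sign fmorphV rmorph_nat.
by field.
Qed.

(** The norm is [(1 + p) / 4], which is even because [p] is 7 modulo 8; this is the splitting of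
    2. *)
Lemma quad_half_norm i : exists c : int, quad_half i * (1 - quad_half i) = 2 * c%:~R.
Proof.
have [q pE] : exists q, p = (8 * q + 7)%N by exists (p %/ 8)%N; lia.
exists (q.+1)%:Z; rewrite /quad_half.
transitivity ((1 - ((-1) ^+ i) ^+ 2 * s ^+ 2) / 4 : algC); first by field.
rewrite sqrr_sign mul1r sqrt_sqr pE opprK natrD natrM -[_%:Z%:~R]/(_%:R) -natr1; by field.
Qed.

Lemma quad_int_half i : O (quad_half i).
Proof.
split; last first.
  exists (1 / 2), ((-1) ^+ i / 2).
  rewrite /quad_half !fmorph_div !rmorph_sign !rmorph1 !rmorph_nat.
  by field.
have [c cE] := quad_half_norm i.
apply: (@root_monic_Aint ('X^2 - ('X - (2 * c%:~R)%:P))).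
- rewrite /root !hornerE -cE; apply/eqP; ring.
- rewrite monicE lead_coefDl ?lead_coefXn // size_polyN size_XsubC size_polyXn //.
- apply/polyOverP=> j; rewrite !coefB coefXn coefX coefC.
  by do 3! case: eqP => _;
    rewrite !(rpredB, rpredM, rpred0, rpred1) ?intr_int ?(natr_int _ 2).
Qed.

Lemma quad_int_basis i x : O x -> exists a b : int, x = a%:~R + b%:~R * quad_half i.
Proof.
move=> /quad_intP[A [B [-> /dvdzP[c AB] _]]].
have -> : A = c * 2 + B by lia.
exists (if i then c + B else c), ((-1) ^+ i * B); rewrite /quad_half.
by case: i; rewrite ?expr0 ?expr1 ?mulN1r ?mul1r !(intrD, intrM, intrN); field.
Qed.

(** * Ideals and their powers *)

Section Ideals.
Variable I : algC -> Prop.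
Hypothesis I_ideal : is_ideal p I.

Lemma ideal_sub x : I x -> O x. Proof. by case: I_ideal => H _ _ _; apply: H. Qed.
Lemma ideal0 : I 0. Proof. by case: I_ideal. Qed.
Lemma idealD x y : I x -> I y -> I (x + y).
Proof. by case: I_ideal => _ _ H _; apply: H. Qed.
Lemma idealM a x : O a -> I x -> I (a * x).
Proof. by case: I_ideal => _ _ _ H; apply: H. Qed.
Lemma idealB x y : I x -> I y -> I (x - y).
Proof.
move=> Ix Iy; apply: idealD => //; rewrite -mulN1r; apply: idealM => //.
exact/quad_intN/quad_int1.
Qed.
Lemma ideal_sum (T : eqType) (r : seq T) (F : T -> algC) :
  (forall u, u \in r -> I (F u)) -> I (\sum_(u <- r) F u).
Proof.
elim: r => [|u r IHr] Ir; first by rewrite big_nil; apply: ideal0.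
rewrite big_cons; apply: idealD; first by apply: Ir; rewrite mem_head.
by apply: IHr => v rv; apply: Ir; rewrite inE rv orbT.
Qed.
End Ideals.

Lemma quad_int_ideal : is_ideal p O.
Proof. split=> //; [exact: quad_int_int 0|exact: quad_intD|exact: quad_intM]. Qed.

Lemma ideal_mul_mem I J x y : I x -> J y -> ideal_mul I J (x * y).
Proof. by move=> Ix Jy; exists [:: (x, y)]; [move=> u /[!inE]/eqP-> | rewrite big_seq1]. Qed.

Lemma ideal_mul_ideal I J : is_ideal p I -> is_ideal p J -> is_ideal p (ideal_mul I J).
Proof.
move=> iI iJ; split.
- move=> _ [r IJr ->]; apply: (ideal_sum quad_int_ideal) => u /IJr[Iu Ju].
  by apply: quad_intM; [apply: ideal_sub Iu | apply: ideal_sub Ju].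
- by exists [::] => //; rewrite big_nil.
- move=> _ _ [r IJr ->] [t IJt ->]; exists (r ++ t); last by rewrite big_cat.
  by move=> u; rewrite mem_cat => /orP[/IJr|/IJt].
move=> a _ Oa [r IJr ->]; exists [seq (a * u.1, u.2) | u <- r].
  by move=> _ /mapP[u /IJr[Iu Ju] ->]; split=> //; apply: idealM.
by rewrite big_map mulr_sumr; apply: eq_bigr => u _; rewrite mulrA.
Qed.

Lemma ideal_exp_ideal I d : is_ideal p I -> is_ideal p (ideal_exp p I d).
Proof.
by move=> iI; elim: d => [|d IHd]; [exact: quad_int_ideal | exact: ideal_mul_ideal].
Qed.

Lemma ideal_expD I d e x y : is_ideal p I ->
  ideal_exp p I d x -> ideal_exp p I e y -> ideal_exp p I (d + e) (x * y).
Proof.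
move=> iI; elim: d x => [|d IHd] x Ix Iy; first exact/(idealM (ideal_exp_ideal e iI)).
case: Ix => r Ir ->; rewrite mulr_suml.
apply: (ideal_sum (ideal_exp_ideal (d + e).+1 iI)) => u /Ir[Iu1 Iu2].
by rewrite -mulrA; apply: ideal_mul_mem => //; apply: IHd.
Qed.

Lemma ideal_expX I d x : is_ideal p I -> I x -> ideal_exp p I d (x ^+ d).
Proof.
move=> iI Ix; elim: d => [|d IHd]; first exact: quad_int1.
by rewrite exprS; apply: ideal_mul_mem.
Qed.

(** If [a I = b O], then [b] itself lies in [a I], and [g = b / a] generates [I]. *)
Lemma principal_generator I : same_ideal_class p I O ->
  exists2 g, I g & forall x, I x -> exists2 w, O w & x = g * w.
Proof.
case=> a [b [_ _ a0 b0 IE]].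
have [g Ig bE] := (IE b).2 (ex_intro2 _ _ 1 quad_int1 (esym (mulr1 b))).
exists g => // x Ix; have [w Ow axE] := (IE (a * x)).1 (ex_intro2 _ _ x Ix erefl).
by exists w => //; apply: (mulfI a0); rewrite axE bE mulrA.
Qed.

(** * Powers of a prime ideal above 2 *)

Section PrimeAbove2.
Variable P : algC -> Prop.
Hypothesis P_prime : is_prime_ideal p P.
Hypothesis P_2 : P 2.

Let P_ideal : is_ideal p P. Proof. by case: P_prime. Qed.
Let expP_ideal d := ideal_exp_ideal d P_ideal.

(** The product of the two conjugates [quad_half] is a multiple of 2, so [P] contains one of them,
    [t]. In the basis 1, [t], an element of [P] has even first coordinate, since an odd one would
    put 1 in [P]. *)
Lemma prime_above_2_uniformizer : exists t, [/\ O t, P t, t^* = 1 - t,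
  exists c : int, t * (1 - t) = 2 * c%:~R &
  forall x, P x -> exists a b : int, x = 2 * a%:~R + b%:~R * t].
Proof.
have [_ P_1 P_mul] := P_prime.
have [i Pi] : exists i, P (quad_half i).
  have half1 : quad_half true = 1 - quad_half false.
    by rewrite /quad_half expr0 expr1; field.
  have [c cE] := quad_half_norm false.
  have Phalf : P (quad_half false * quad_half true).
    by rewrite half1 cE mulrC; apply: idealM => //; apply: quad_int_int.
  by have [Pi|Pi] := P_mul _ _ (quad_int_half false) (quad_int_half true) Phalf;
    [exists false | exists true].
exists (quad_half i); split=> //; [exact: quad_int_half | exact: quad_half_conj |
  exact: quad_half_norm | move=> x Px].
have [a [b xE]] := quad_int_basis i (ideal_sub P_ideal Px).
have Pa : P a%:~R.
  have -> : a%:~R = x - b%:~R * quad_half i by rewrite xE addrK.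
  by apply: idealB => //; apply: idealM => //; apply: quad_int_int.
have [c [aE|aE]] : exists c, a = 2 * c \/ a = 2 * c + 1 by exists (a %/ 2)%Z; lia.
  by exists c, b; rewrite xE aE intrM.
case: P_1; have -> : 1 = a%:~R - c%:~R * 2 :> algC by rewrite aE intrD intrM; ring.
by apply: idealB => //; apply: idealM => //; apply: quad_int_int.
Qed.

(** One half of the identity between [2 ^+ d] and the product of [P^d] with its conjugate;
    [pow2_sum] is the other half. For [d = 1] it comes from [t * t^* = 2 * c]. *)
Lemma ideal_exp_norm d x y : ideal_exp p P d x -> ideal_exp p P d y ->
  exists2 w, O w & x * y^* = 2 ^+ d * w.
Proof.
have [t [Ot Pt tc [c tE] P_t]] := prime_above_2_uniformizer.
have norm1 u v : P u -> P v -> exists2 w, O w & u * v^* = 2 * w.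
  move=> /P_t[a [b ->]] /P_t[a' [b' ->]].
  exists (2 * a%:~R * a'%:~R + a%:~R * b'%:~R * t^* + b%:~R * a'%:~R * t
    + b%:~R * b'%:~R * c%:~R).
    have O2 : O 2 := quad_int_int 2.
    by do ! (apply: quad_intD || apply: quad_intM) => //;
      solve [exact: quad_int_int | exact: quad_int_conj].
  rewrite rmorphD !rmorphM /= !rmorph_int rmorph_nat tc.
  transitivity (2 * (2 * a%:~R * a'%:~R + a%:~R * b'%:~R * (1 - t) + b%:~R * a'%:~R * t)
    + b%:~R * b'%:~R * (t * (1 - t))); first ring.
  rewrite tE; ring.
elim: d x y => [|d IHd] x y.
  by move=> Ox Oy; exists (x * y^*); rewrite ?mul1r //; apply/quad_intM/quad_int_conj.
case=> r Pr -> [q Pq ->].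
pose J z := exists2 w, O w & z = 2 ^+ d.+1 * w.
have J_ideal : is_ideal p J.
  split.
  - move=> _ [w Ow ->]; apply: quad_intM => //.
    by have := quad_int_int (2 ^+ d.+1); rewrite rmorphXn.
  - by exists 0; rewrite ?mulr0 //; exact: quad_int_int 0.
  - move=> _ _ [w Ow ->] [v Ov ->]; exists (w + v); rewrite ?mulrDr //; exact: quad_intD.
  - move=> a _ Oa [w Ow ->]; exists (a * w); [exact: quad_intM | ring].
suff : J ((\sum_(u <- r) u.1 * u.2) * (\sum_(v <- q) v.1 * v.2)^*) by [].
rewrite mulr_suml; apply: (ideal_sum J_ideal) => u /Pr[Pu1 Pu2].
rewrite rmorph_sum mulr_sumr; apply: (ideal_sum J_ideal) => v /Pq[Pv1 Pv2].
have [w Ow wE] := norm1 _ _ Pu1 Pv1; have [w' Ow' wE'] := IHd _ _ Pu2 Pv2.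
exists (w * w'); first exact: quad_intM.
transitivity ((u.1 * v.1^*) * (u.2 * v.2^*)); first by rewrite rmorphM; ring.
by rewrite wE wE' exprS; ring.
Qed.

(** As [t + t^* = 1], one has [2 = 2 * t^* + t * 2]; each induction step multiplies by this
    expression. *)
Lemma pow2_sum d : exists2 r : seq (algC * algC),
  (forall u, u \in r -> ideal_exp p P d u.1 /\ ideal_exp p P d u.2)
  & 2 ^+ d = \sum_(u <- r) u.1 * (u.2)^*.
Proof.
have [t [Ot Pt tc _ _]] := prime_above_2_uniformizer.
elim: d => [|d [r Pr rE]].
  exists [:: (1, 1)]; last by rewrite big_seq1 /= rmorph1 mulr1.
  by move=> u /[!inE]/eqP->; split; exact: quad_int1.
exists ([seq (2 * u.1, t * u.2) | u <- r] ++ [seq (t * u.1, 2 * u.2) | u <- r]).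
  by move=> u; rewrite mem_cat => /orP[] /mapP[v /Pr[Pv1 Pv2] ->]; split; apply: ideal_mul_mem.
rewrite big_cat !big_map /= -big_split exprS rE mulr_sumr; apply: eq_bigr => u _ /=.
rewrite !rmorphM /= tc rmorph_nat; ring.
Qed.

(** By the two halves, [g * g^*] and [2 ^+ d] divide each other. The quotient [w] is a unit, so it
    has norm 1, and both numbers are nonnegative with the same square. *)
Lemma ideal_exp_generator_norm d g : ideal_exp p P d g ->
    (forall x, ideal_exp p P d x -> exists2 w, O w & x = g * w) ->
  g * g^* = 2 ^+ d.
Proof.
move=> Pg gen; have [w Ow wE] := ideal_exp_norm Pg Pg.
have [v Ov vE] : exists2 v, O v & 2 ^+ d = g * g^* * v.
  have [r Pr ->] := pow2_sum d.
  pose J z := exists2 v, O v & z = g * g^* * v.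
  have Og := ideal_sub (expP_ideal d) Pg.
  have J_ideal : is_ideal p J.
    split.
    - by move=> _ [v Ov ->]; do 2! apply: quad_intM => //; apply: quad_int_conj.
    - by exists 0; rewrite ?mulr0 //; exact: quad_int_int 0.
    - move=> _ _ [v Ov ->] [v' Ov' ->]; exists (v + v'); rewrite ?mulrDr //; exact: quad_intD.
    - move=> a _ Oa [v Ov ->]; exists (a * v); [exact: quad_intM | ring].
  apply: (ideal_sum J_ideal) => u /Pr[/gen[v Ov ->] /gen[v' Ov' ->]].
  exists (v * v'^*); first exact/quad_intM/quad_int_conj.
  by rewrite rmorphM; ring.
have [n nE] := quad_int_norm (ideal_sub (expP_ideal d) Pg).
have pow2_neq0 : 2 ^+ d != 0 :> algC by rewrite expf_neq0 // pnatr_eq0.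
have gg_neq0 : g * g^* != 0 by apply: contraNneq pow2_neq0 => gg0; rewrite vE gg0 mul0r.
have wv : w * v = 1.
  by apply: (mulfI pow2_neq0); rewrite mulrA -wE -vE mulr1.
have [[a aE] [b bE]] := (quad_int_norm Ow, quad_int_norm Ov).
have ab : (a * b)%N == 1%N.
  by rewrite -(@eqr_nat algC) natrM -aE -bE mulrACA -rmorphM wv rmorph1 mulr1.
have a1 : w * w^* = 1 by move: ab; rewrite muln_eq1 aE => /andP[/eqP-> _].
have gg_real : (g * g^*)^* = g * g^* by rewrite rmorphM /= conjCK mulrC.
apply/eqP; rewrite -(@eqrXn2 _ 2) ?mul_conjC_ge0 ?exprn_ge0 //.
by rewrite expr2 -{2}gg_real wE rmorphM rmorphXn rmorph_nat mulrACA a1 mulr1.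
Qed.

(** If 2 divided [g], it would divide [t ^+ d] and so its conjugate. Then [P] would contain [t^*]
    besides [t], hence [t + t^* = 1]. *)
Lemma generator_not_even d g : 
    (forall x, ideal_exp p P d x -> exists2 w, O w & x = g * w) ->
  forall w, O w -> g <> 2 * w.
Proof.
move=> gen w Ow gE; have [t [Ot Pt tc _ _]] := prime_above_2_uniformizer.
have [_ P_1 P_mul] := P_prime.
have [v Ov tE] := gen _ (ideal_expX d P_ideal Pt).
have Ptc : P (t^* ^+ d).
  rewrite -rmorphXn /= tE gE.
  have -> : (2 * w * v)^* = (w^* * v^*) * 2 by rewrite !rmorphM rmorph_nat; ring.
  by apply: idealM => //; apply: quad_intM; exact: quad_int_conj.
have {}Ptc : P t^*.
  elim: d Ptc {gen tE} => [|d IHd]; first by rewrite expr0.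
  rewrite exprS => /P_mul[||//|//]; first exact: quad_int_conj.
  elim: d {IHd} => [|d IHd]; [exact: quad_int1 | rewrite exprS].
  by apply: quad_intM => //; exact: quad_int_conj.
by apply: P_1; have -> : 1 = t + t^* by [rewrite tc; ring]; apply: idealD.
Qed.

Lemma quad_sqrt e g : O g -> g * g^* = 2 ^+ (2 * e) -> (0 < e)%N ->
    (forall w, O w -> g <> 2 * w) ->
  exists2 b, O b & exists i : bool, b ^+ 2 = (-1) ^+ i * g.
Proof.
move=> Og gg e_gt0 not_even; have [A [B [gE AB nE]]] := quad_intP Og.
have AB_eq : A ^+ 2 + p%:Z * B ^+ 2 = (2 ^+ e.+1) ^+ 2.
  apply: (@intr_inj algC); rewrite -[LHS](mulfVK (_ : 4 != 0)) ?pnatr_eq0 //.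
  rewrite -nE gg mulnC exprM (exprS (2 : int) e) exprMn intrM.
  rewrite !rmorphXn /= -[2%:~R]/(2%:R); ring.
(* If [A] is even then so is [B]. As [0 < e], the halves [a] and [b] have even norm form, hence
   equal parity, and [g / 2] would be an integer of the field. *)
have A_odd : odd `|A|%N.
  apply: contraT => A_even.
  have [a aE] : exists a, A = 2 * a by exists (A %/ 2)%Z; lia.
  have [b bE] : exists b, B = 2 * b by exists (B %/ 2)%Z; lia.
  have ab2 : (2 %| a - b)%Z.
    apply: dvd2_norm; have -> : a ^+ 2 + p%:Z * b ^+ 2 = (2 ^+ e) ^+ 2.
      apply: (mulfI (_ : 4 != 0)) => //; transitivity (A ^+ 2 + p%:Z * B ^+ 2).
        by rewrite aE bE; ring.
      by rewrite AB_eq (exprS (2 : int) e); ring.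
    by rewrite expr2 -(prednK e_gt0) exprS -mulrA dvdz_mulr.
  have [c cE] := dvdzP ab2.
  case: (not_even (c%:~R + b%:~R * quad_half false)).
    by apply: quad_intD; [|apply: quad_intM]; try exact: quad_int_int; exact: quad_int_half.
  have aE' : a = c * 2 + b by lia.
  by rewrite gE aE bE aE' /quad_half expr0 mul1r !(intrD, intrM); field.
have B_neq0 : B != 0 by lia.
have [r [s' [i [sqE rsE]]]] := sum_sqr_prime_sqr p_prime A_odd B_neq0 AB_eq.
pose b : algC := (s'%:~R + r%:~R * s) / 2.
have bE : b ^+ 2 = (-1) ^+ i * g.
  transitivity ((s'%:~R ^+ 2 + r%:~R ^+ 2 * s ^+ 2 + 2 * (s'%:~R * r%:~R) * s) / 4 : algC).
    by rewrite /b; field.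
  have sq : s'%:~R ^+ 2 - p%:R * r%:~R ^+ 2 = (-1) ^+ i * (2 * A%:~R) :> algC.
    have := congr1 (fun z : int => z%:~R : algC) sqE.
    by rewrite intrB !intrM rmorph_sign.
  have rs : s'%:~R * r%:~R = (-1) ^+ i * B%:~R :> algC.
    by have := congr1 (fun z : int => z%:~R : algC) rsE; rewrite !intrM rmorph_sign.
  by rewrite sqrt_sqr rs mulrN [_ * p%:R]mulrC sq gE; field.
exists b; last by exists i.
split; last first.
  exists (s'%:~R / 2), (r%:~R / 2); rewrite !fmorph_div !rmorph_int !rmorph_nat /b; by field.
apply: Aint_sqr; rewrite bE; case: Og => Ag _.
by case: (i); rewrite ?expr0 ?expr1 ?mulN1r ?mul1r ?rpredN.
Qed.

Lemma ideal_exp_half_principal e g : (0 < e)%N -> ideal_exp p P (2 * e) g ->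
    (forall x, ideal_exp p P (2 * e) x -> exists2 w, O w & x = g * w) ->
  same_ideal_class p (ideal_exp p P e) O.
Proof.
move=> e_gt0 Pg gen; have gg := ideal_exp_generator_norm Pg gen.
have Og := ideal_sub (expP_ideal _) Pg.
have [b Ob [i bE]] := quad_sqrt Og gg e_gt0 (generator_not_even gen).
have bb : b * b^* = 2 ^+ e.
  apply/eqP; rewrite -(@eqrXn2 _ 2) ?mul_conjC_ge0 ?exprn_ge0 //.
  rewrite exprMn -rmorphXn bE rmorphM rmorph_sign mulrACA -expr2 sqrr_sign mul1r gg.
  by rewrite mulnC exprM.
have pow2_neq0 : 2 ^+ e != 0 :> algC by rewrite expf_neq0 // pnatr_eq0.
have b_neq0 : b != 0 by apply: contraNneq pow2_neq0 => b0; rewrite -bb b0 mul0r.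
have bc_neq0 : b^* != 0 by apply: contraNneq pow2_neq0 => b0; rewrite -bb b0 mulr0.
(* [x ^+ 2] lies in [P^(2e)], so it is a multiple of [g]; thus [(x / b) ^+ 2] is integral, and so is
   [x / b]. *)
have divb x : ideal_exp p P e x -> exists2 w, O w & x = b * w.
  move=> Px; exists (x / b); last by rewrite mulrC divfK.
  have Ox := ideal_sub (expP_ideal _) Px.
  split.
    have [w [Aw _] xE] : exists2 w, O w & x * x = g * w.
      by apply: gen; rewrite mul2n -addnn; apply: ideal_expD.
    apply: Aint_sqr; rewrite expr_div_n bE expr2 xE.
    have -> : g * w / ((-1) ^+ i * g) = (-1) ^+ i * w.
      have g_neq0 : g != 0.
        by apply: contraNneq b_neq0 => g0; rewrite -sqrf_eq0 bE g0 mulr0.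
      by case: (i); rewrite ?expr0 ?expr1; field.
    by case: (i); rewrite ?expr0 ?expr1 ?mulN1r ?mul1r ?rpredN.
  have [_ [u [v xbE]]] := quad_intM Ox (quad_int_conj Ob).
  exists (u / 2 ^+ e), (v / 2 ^+ e).
  have -> : x / b = x * b^* / 2 ^+ e by rewrite -bb invfM mulrACA mulfV // mulr1.
  by rewrite xbE !fmorph_div /= !rmorphXn /= rmorph_nat mulrDl [X in _ + X]mulrAC.
(* In [b * b^* = 2 ^+ e], written as in [pow2_sum], each conjugated factor is a multiple of [b^*];
   cancelling [b^*] leaves [b] as an element of [P^e]. *)
have Pb : ideal_exp p P e b.
  have [r Pr pow2E] := pow2_sum e.
  have : 2 ^+ e = b * b^* by rewrite bb.
  rewrite pow2E.
  have J_ideal : is_ideal p (fun z => exists2 y, ideal_exp p P e y & z = b^* * y).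
    split.
    - by move=> _ [y Py ->]; apply: quad_intM;
        [exact: quad_int_conj | exact: ideal_sub (expP_ideal e) _ Py].
    - by exists 0; rewrite ?mulr0 //; apply: ideal0.
    - move=> _ _ [y Py ->] [z Pz ->]; exists (y + z); rewrite ?mulrDr //; exact: idealD.
    - move=> a _ Oa [y Py ->]; exists (a * y); [exact: idealM | ring].
  have [|y Py ->] := ideal_sum J_ideal (r := r) (F := fun u => u.1 * (u.2)^*).
    move=> u /Pr[Pu1 /divb[w Ow ->]]; exists (w^* * u.1); last by rewrite rmorphM; ring.
    by apply: idealM => //; exact: quad_int_conj.
  by rewrite [RHS]mulrC => /(mulfI bc_neq0) <-.
exists 1, b; split=> //; [exact: quad_int1 | exact: oner_neq0 | move=> z; split].
  by case=> x /divb[w Ow ->] ->; exists w; rewrite ?mul1r.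
by case=> w Ow ->; exists (w * b); [exact: idealM | rewrite mul1r mulrC].
Qed.

Lemma class_order_odd n : is_class_order p P n -> odd n.
Proof.
case=> n_gt0 Pn min_n; apply: contraT => n_even.
have [e nE] : exists e, n = (2 * e)%N by exists n./2; lia.
have e_gt0 : (0 < e)%N by lia.
rewrite nE in Pn; have [g Pg gen] := principal_generator Pn.
have := min_n e e_gt0 (ideal_exp_half_principal e_gt0 Pg gen); lia.
Qed.

End PrimeAbove2.
End QuadraticIntegers.

End OddClassOrder.

(** * Distances in the folded component *)

Section Walks.
Variables (T : finType) (G : {set {set T}}).

Definition walk_of_size (x y : T) (d : nat) := exists2 s, is_walk G x y s & size s = d.

Lemma walk_of_size0 x : walk_of_size x x 0.
Proof. by exists [::]. Qed.

Lemma walk_of_size1 x y : adj G x y -> walk_of_size x y 1.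
Proof. by move=> xy; exists [:: y]; rewrite // /is_walk /= xy. Qed.

Lemma walk_of_size_cat y x z d e :
  walk_of_size x y d -> walk_of_size y z e -> walk_of_size x z (d + e).
Proof.
move=> [s [ps ls] <-] [t [pt lt] <-]; exists (s ++ t); last by rewrite size_cat.
by split; rewrite ?cat_path ?last_cat ls // ps.
Qed.

Lemma adj_sym : symmetric (adj G).
Proof. by move=> x y; rewrite /adj eq_sym setUC. Qed.

Lemma walk_of_size_sym x y d : walk_of_size x y d -> walk_of_size y x d.
Proof.
move=> [s [ps <-] <-]; elim: s x ps => [|z s IHs] x /=; first by exists [::].
case/andP=> xz /IHs ws; rewrite -addn1.
by apply: (walk_of_size_cat ws); apply: walk_of_size1; rewrite adj_sym.
Qed.

Lemma is_dist_walk x y d :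
  walk_of_size x y d -> exists2 e, is_dist G x y e & e <= d.
Proof.
(* Walks of a fixed length form a finite type, so a least length can be extracted from a boolean
   predicate. *)
pose P e := [exists s : e.-tuple T, path (adj G) x s && (last x s == y)].
have PP s : is_walk G x y s -> P (size s).
  by case=> ps ls; apply/existsP; exists (in_tuple s); rewrite ps ls /=.
move=> [s ws <-]; have exP : exists e, P e by exists (size s); apply: PP.
case: (ex_minnP exP) => e /existsP[t /andP[pt /eqP lt]] min_e.
exists e; last exact/min_e/PP.
split; first by exists t; rewrite ?size_tuple.
by move=> u /PP/min_e.
Qed.

Lemma lipschitz_walk (f : T -> nat) x y s :
    (forall u v, adj G u v -> f v <= (f u).+1) ->
  is_walk G x y s -> f y <= f x + size s.
Proof.
move=> lip [ps <-]; elim: s x ps => [|z s IHs] x /=; first by rewrite addn0.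
by case/andP=> /lip fz /IHs fs; rewrite addnS -addSn (leq_trans fs) ?leq_add2r.
Qed.

(** Walks bound all distances from above; a function that grows by at most 1 along every edge bounds
    one distance from below. *)
Lemma is_diameterP D (f : T -> nat) x y :
    (forall u v, exists2 d, walk_of_size u v d & d <= D) ->
    (forall u v, adj G u v -> f v <= (f u).+1) -> f x = 0 -> D <= f y ->
  is_diameter G D.
Proof.
move=> short lip fx fy; split=> [|u v]; last first.
  have [d /is_dist_walk[e de le_ed] le_dD] := short u v.
  by exists e; last exact: leq_trans le_dD.
exists x, y; have [d /is_dist_walk[e de le_ed] le_dD] := short x y.
suff -> : D = e by [].
have [[s ws se] _] := de; have := lipschitz_walk lip ws.
by rewrite se fx => /(leq_trans fy) le_De; apply/eqP; rewrite eqn_leq le_De (leq_trans le_ed).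
Qed.
End Walks.

(** * Tree distances *)

Lemma set2_eq_edge n (x y : 'I_n) a b :
  x != y -> [set x; y] = edge n a b ->
  (val x = a /\ val y = b) \/ (val x = b /\ val y = a).
Proof.
move=> nxy Exy; have : (x \in edge n a b) && (y \in edge n a b).
  by rewrite -Exy !inE !eqxx orbT.
rewrite !inE; move: nxy; rewrite -val_eqE /=; lia.
Qed.

Lemma edge_val n (x y : 'I_n) : edge n x y = [set x; y].
Proof. by apply/setP=> z; rewrite !inE -!val_eqE. Qed.

(* Vertex x lies on, or hangs from, the spine vertex 2 * spine_pos x + 1; since
   0.-1 = 0 this is also right for the vertex 0. *)
Definition spine_pos (x : nat) := x.-1./2.

(** Each even vertex is a leaf and costs one step to the spine; the two truncated differences add up
    to an absolute value. Without the first case a leaf would be at distance 2 from itself. *)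
Definition tree_dist (x y : nat) : nat :=
  if x == y then 0
  else ~~ odd x + ~~ odd y + (spine_pos x - spine_pos y) + (spine_pos y - spine_pos x).

Lemma adj_folded n (x y : 'I_n) : adj (folded n) x y -> tree_dist x y = 1.
Proof.
case/andP=> nxy; rewrite !inE -orbA => /or3P[/imsetP[i]|/imsetP[i]|/eqP].
- rewrite inE => ib /(set2_eq_edge nxy); rewrite /tree_dist /spine_pos /=.
  case: ifP; lia.
- rewrite inE => ib /(set2_eq_edge nxy); rewrite /tree_dist /spine_pos /=.
  case: ifP; lia.
- move/(set2_eq_edge nxy); rewrite /tree_dist /spine_pos /=.
  case: ifP; lia.
Qed.

Lemma tree_dist_sym : commutative tree_dist.
Proof. move=> x y; rewrite /tree_dist eq_sym; case: ifP; lia. Qed.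

Lemma tree_distxx x : tree_dist x x = 0.
Proof. by rewrite /tree_dist eqxx. Qed.

Lemma tree_dist_triangle y x z : tree_dist x z <= tree_dist x y + tree_dist y z.
Proof.
have [<-|nxz] := eqVneq x z; first by rewrite tree_distxx.
have [<-|nxy] := eqVneq x y; first by rewrite tree_distxx.
have [->|nyz] := eqVneq y z; first by rewrite tree_distxx addn0.
rewrite /tree_dist !ifN //; move: (~~ odd x) (~~ odd y) (~~ odd z) => [] [] [] /=; lia.
Qed.

Lemma tree_dist_walk n (x y : 'I_n) :
  odd n -> 1 < n -> walk_of_size (folded n) x y (tree_dist x y).
Proof.
move=> n_odd n_gt1.
have spine_walk i j (u v : 'I_n) : i <= j -> val u = 2 * i + 1 -> val v = 2 * j + 1 ->
    walk_of_size (folded n) u v (j - i).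
  elim: j v => [|j IHj] v.
    rewrite leqn0 => /eqP -> uE vE; have -> : u = v by apply: val_inj; rewrite uE vE.
    exact: walk_of_size0.
  rewrite leq_eqVlt => /predU1P[-> uE vE|lt_ij uE vE].
    have -> : u = v by apply: val_inj; rewrite uE vE.
    by rewrite subnn; apply: walk_of_size0.
  have ltv := ltn_ord v; rewrite [nat_of_ord v]vE in ltv.
  have ltw : 2 * j + 1 < n by lia.
  have ltj : j.+1 < n by lia.
  rewrite subSn // -addn1; apply: (walk_of_size_cat (y := Ordinal ltw)).
    exact: IHj.
  apply: walk_of_size1; rewrite /adj -val_eqE /= -edge_val !inE /=.
  rewrite [nat_of_ord v]vE; apply/andP; split; first lia.
  (* Here [2 * j + 3 < n] with [n] odd gives [j + 1 <= (n - 3) / 2], so this spine edge exists. *)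
  apply/orP; left; apply/orP; left; apply/imsetP; exists (Ordinal ltj).
    by rewrite inE /=; lia.
  by congr edge => /=; lia.
have to_spine (u : 'I_n) : exists2 v : 'I_n, val v = 2 * spine_pos u + 1 &
    walk_of_size (folded n) u v (~~ odd u).
  case: (boolP (odd u)) => [u_odd|u_even].
    by exists u; [rewrite /spine_pos /=; lia | apply: walk_of_size0].
  have ltu := ltn_ord u.
  have ltv : 2 * spine_pos u + 1 < n by rewrite /spine_pos; lia.
  exists (Ordinal ltv) => //; apply: walk_of_size1.
  rewrite adj_sym /adj -val_eqE /= -edge_val !inE /=; apply/andP; split; first lia.
  have [u0|u_gt0] := posnP u.
    by apply/orP; right; apply/eqP/setP=> z; rewrite !inE /= u0 orbC.
  apply/orP; left; apply/orP; right; apply/imsetP.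
  have ltj : spine_pos u < n by rewrite /spine_pos; lia.
  exists (Ordinal ltj); first by rewrite inE /= /spine_pos; lia.
  by congr edge => /=; rewrite /spine_pos; lia.
have [<-|nxy] := eqVneq x y; first by rewrite tree_distxx; apply: walk_of_size0.
have [u uE wx] := to_spine x; have [v vE wy] := to_spine y.
have wuv : walk_of_size (folded n) u v
    ((spine_pos x - spine_pos y) + (spine_pos y - spine_pos x)).
  case: (leqP (spine_pos x) (spine_pos y)) => [le_xy|/ltnW le_yx].
    by rewrite (eqP (_ : _ - _ == 0)) ?subn_eq0 //; apply: spine_walk.
  rewrite [X in _ + X](eqP (_ : _ - _ == 0)) ?subn_eq0 // addn0.
  by apply: walk_of_size_sym; apply: spine_walk.
have := walk_of_size_cat wx (walk_of_size_cat wuv (walk_of_size_sym wy)).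
suff -> // : ~~ odd x + (spine_pos x - spine_pos y + (spine_pos y - spine_pos x) + ~~ odd y)
  = tree_dist x y by [].
rewrite /tree_dist ifN ?val_eqE //; lia.
Qed.

(** * Distances after adding an edge *)

Definition shortcut_dist (a b x y : nat) : nat :=
  minn (tree_dist x y)
    (minn (tree_dist x a + 1 + tree_dist b y) (tree_dist x b + 1 + tree_dist a y)).

Lemma walk_of_size_add_edge (T : finType) (G : {set {set T}}) e x y d :
  walk_of_size G x y d -> walk_of_size (add_edge G e) x y d.
Proof.
move=> [s [ps ls] ds]; exists s => //; split=> //.
apply: sub_path ps => u v; rewrite /adj /add_edge => /andP[-> uvG].
by rewrite inE uvG orbT.
Qed.

(** The distance formula from [x] serves as the slowly growing function: along tree edges by the
    triangle inequality, along the new edge because the minimum includes both crossings. *)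
Lemma is_diameter_shortcut n a b D (x y : nat) :
    odd n -> 1 < n -> a < n -> b < n -> a != b ->
    (forall u v, u < n -> v < n -> shortcut_dist a b u v <= D) ->
    x < n -> y < n -> D <= shortcut_dist a b x y ->
  is_diameter (add_edge (folded n) (edge n a b)) D.
Proof.
move=> n_odd n_gt1 lta ltb nab dist_le ltx lty le_Dxy.
set G := add_edge _ _.
pose oa := Ordinal lta; pose ob := Ordinal ltb.
have tree_walk (u v : 'I_n) : walk_of_size G u v (tree_dist u v).
  by apply: walk_of_size_add_edge; apply: tree_dist_walk.
have walk_ab : walk_of_size G oa ob 1.
  apply: walk_of_size1; rewrite /adj -val_eqE nab /=.
  by rewrite -(edge_val oa ob) setU11.
apply: (@is_diameterP _ G D (fun z => shortcut_dist a b x z) (Ordinal ltx) (Ordinal lty)).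
- move=> u v; exists (shortcut_dist a b u v); last exact: dist_le.
  have ab := walk_of_size_cat (walk_of_size_cat (tree_walk u oa) walk_ab) (tree_walk ob v).
  have ba := walk_of_size_cat
    (walk_of_size_cat (tree_walk u ob) (walk_of_size_sym walk_ab)) (tree_walk oa v).
  by rewrite /shortcut_dist; case: leqP => _ //; case: leqP => _.
- move=> u v /andP[nuv]; rewrite /G in_setU1 => /orP[/eqP /(set2_eq_edge nuv) /=|uv].
    have := (tree_distxx a, tree_distxx b); rewrite /shortcut_dist.
    by case=> aa bb [] [-> ->]; lia.
  have uv1 : tree_dist u v = 1 by apply: adj_folded; rewrite /adj nuv.
  have := (tree_dist_triangle u x v, tree_dist_triangle u a v, tree_dist_triangle u b v).
  by rewrite uv1 /shortcut_dist => -[[xv av] bv]; lia.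
- by rewrite /shortcut_dist tree_distxx min0n.
- exact: le_Dxy.
Qed.

Lemma spine_pos_floor i : spine_pos (2 * i + 2) = i.
Proof. rewrite /spine_pos; lia. Qed.

Lemma tree_dist_le x y :
  tree_dist x y <= 2 + (spine_pos x - spine_pos y) + (spine_pos y - spine_pos x).
Proof.
rewrite /tree_dist; case: ifP => // _.
by rewrite !leq_add // (leq_add (leq_b1 _) (leq_b1 _)).
Qed.

Lemma tree_dist_lower x y : ~~ odd x -> ~~ odd y -> x != y ->
  tree_dist x y = 2 + (spine_pos x - spine_pos y) + (spine_pos y - spine_pos x).
Proof. by rewrite /tree_dist => -> -> /negbTE->. Qed.

Lemma shortcut_dist_sym a b : commutative (shortcut_dist a b).
Proof.
move=> x y; rewrite /shortcut_dist (tree_dist_sym x y) (tree_dist_sym x a) (tree_dist_sym x b).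
rewrite (tree_dist_sym b y) (tree_dist_sym a y); lia.
Qed.

Lemma shortcut_dist_le_tree a b x y : shortcut_dist a b x y <= tree_dist x y.
Proof. exact: geq_minl. Qed.

Lemma shortcut_dist_le_shortcut a b x y :
  shortcut_dist a b x y <= tree_dist x a + 1 + tree_dist b y.
Proof. by rewrite /shortcut_dist minnC -minnA geq_minl. Qed.

(** Spine positions run from 0 to [h - 1], and the new edge closes a cycle over positions [m] to
    [m + k]. Passing over the whole cycle gives the first term. If one vertex lies over the cycle,
    the shorter way round is at most half the sum of both ways; this gives [uphalf k] and the second
    or third term, according to the side of the other vertex. *)
Lemma shortcut_dist_le_large h m k x y : 4 <= k -> m + k < h ->
  x < 2 * h + 1 -> y < 2 * h + 1 ->
  shortcut_dist (2 * m + 2) (2 * (m + k) + 2) x y <=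
  maxn (h + 4 - k) (maxn (uphalf k + (h + 2 - (m + k))) (m + uphalf k + 3)).
Proof.
move=> k4 mkh.
wlog le_xy : x y / spine_pos x <= spine_pos y.
  move=> W ltx lty; case: (leqP (spine_pos x) (spine_pos y)) => [/W|/ltnW/W]; first exact.
  by rewrite shortcut_dist_sym; apply.
move=> ltx lty.
have yh : spine_pos y < h by rewrite /spine_pos; lia.
have := shortcut_dist_le_tree (2 * m + 2) (2 * (m + k) + 2) x y.
have := shortcut_dist_le_shortcut (2 * m + 2) (2 * (m + k) + 2) x y.
have := (tree_dist_le x (2 * m + 2), tree_dist_le (2 * (m + k) + 2) y, tree_dist_le x y).
rewrite !spine_pos_floor; move: (shortcut_dist _ _ _ _) (tree_dist x y).
move: (tree_dist x _) (tree_dist _ y) => d1 d2 d d3 [[d1E d2E] d3E] le_d12 le_d3.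
move: (spine_pos x) (spine_pos y) le_xy yh d1E d2E d3E => i j le_ij ltj d1E d2E d3E.
have [u uE] : exists u, uphalf k = u by exists (uphalf k).
have {}uE : u + u = k \/ u + u = k.+1 by lia.
case: (leqP j m) => jm; first lia.
case: (leqP (m + k) i) => im; first lia.
case: (leqP j (m + k)) => jm'; case: (leqP i m) => im'; lia.
Qed.

Lemma shortcut_dist_le_small h m x y k :
  0 < h -> x < 2 * h + 1 -> y < 2 * h + 1 ->
  shortcut_dist (2 * m + 2) (2 * (m + k) + 2) x y <= h + 1.
Proof.
move=> h_gt0 ltx lty; apply: leq_trans (shortcut_dist_le_tree _ _ _ _) _.
apply: leq_trans (tree_dist_le _ _) _; rewrite /spine_pos; lia.
Qed.

(** Tree distance [h + 1] occurs only between the last floor vertex and a leaf at position 0. The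
    new edge now ends at that floor vertex, and the route over it has length at most [m + 3], which
    is at most [h] since [2 <= k]. *)
Lemma shortcut_dist_le_end h m k x y :  k = 2 \/ k = 3 -> (m + k).+1 = h ->
  x < 2 * h + 1 -> y < 2 * h + 1 ->
  shortcut_dist (2 * m + 2) (2 * (m + k) + 2) x y <= h.
Proof.
move=> k23 mkh.
wlog le_xy : x y / spine_pos x <= spine_pos y.
  move=> W ltx lty; case: (leqP (spine_pos x) (spine_pos y)) => [/W|/ltnW/W]; first exact.
  by rewrite shortcut_dist_sym; apply.
move=> ltx lty.
have [yb|nyb] := eqVneq y (2 * (m + k) + 2).
  have := shortcut_dist_le_tree (2 * m + 2) (2 * (m + k) + 2) x y.
  have := shortcut_dist_le_shortcut (2 * m + 2) (2 * (m + k) + 2) x y.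
  have := (tree_dist_le x (2 * m + 2), tree_dist_le x y).
  rewrite yb spine_pos_floor in le_xy *; rewrite tree_distxx !spine_pos_floor => -[d1E d2E].
  case: (leqP (spine_pos x) m); lia.
apply: leq_trans (shortcut_dist_le_tree _ _ _ _) _.
rewrite /tree_dist; case: ifP => // nxy; rewrite /spine_pos in le_xy *; lia.
Qed.


(** * Diameters attained at explicit vertices *)

Lemma tree_dist_floor i j : i != j ->
  tree_dist (2 * i + 2) (2 * j + 2) = 2 + (i - j) + (j - i).
Proof. by move=> nij; rewrite tree_dist_lower ?spine_pos_floor //; lia. Qed.

Lemma tree_dist0_floor j : tree_dist 0 (2 * j + 2) = 2 + j.
Proof. by rewrite tree_dist_lower /spine_pos //; lia. Qed.

Lemma is_diameter_shortcut_floor h m k D (x y : nat) : 0 < k -> m + k < h ->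
    (forall u v, u < 2 * h + 1 -> v < 2 * h + 1 ->
       shortcut_dist (2 * m + 2) (2 * (m + k) + 2) u v <= D) ->
    x < 2 * h + 1 -> y < 2 * h + 1 ->
    D <= shortcut_dist (2 * m + 2) (2 * (m + k) + 2) x y ->
  is_diameter (add_edge (folded (2 * h + 1))
    (edge (2 * h + 1) (2 * m + 2) (2 * (m + k) + 2))) D.
Proof. move=> k_gt0 mkh; apply: is_diameter_shortcut; lia. Qed.

Lemma diameter_large h m k : 4 <= k -> m + k < h ->
  is_diameter (add_edge (folded (2 * h + 1))
    (edge (2 * h + 1) (2 * m + 2) (2 * (m + k) + 2)))
    (maxn (h + 4 - k) (maxn (uphalf k + (h + 2 - (m + k))) (m + uphalf k + 3))).
Proof.
move=> k4 mkh; set D1 := h + 4 - k; set D2 := uphalf k + _; set D3 := m + _ + 3.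
have le_D u v : u < 2 * h + 1 -> v < 2 * h + 1 ->
    shortcut_dist (2 * m + 2) (2 * (m + k) + 2) u v <= maxn D1 (maxn D2 D3).
  exact: shortcut_dist_le_large.
have k_gt0 : 0 < k by lia.
have [uE ltuk] : uphalf k + uphalf k <= k.+1 /\ k <= uphalf k + uphalf k by lia.
have [D3max|nD3] := boolP (maxn D1 D2 <= D3).
  move: le_D; rewrite maxnA (maxn_idPr D3max) => le_D.
  (* Both ways round to this [y] are nearly equal in length; [4 <= k] keeps its position strictly
     below [m + k]. *)
  apply: (is_diameter_shortcut_floor (x := 0) (y := 2 * (m + 1 + uphalf k) + 2) _ _ le_D);
    rewrite /D3 /shortcut_dist ?tree_dist0_floor ?tree_dist_floor; lia.
(* If the edge ended at the last floor vertex, [D3] would dominate. So the last floor vertex lies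
   beyond the cycle. *)
have nlast : (m + k).+1 < h by move: nD3; rewrite /D1 /D2 /D3; lia.
have [D2max|nD2] := boolP (D1 <= D2).
  have D23 : D3 <= D2 by move: nD3; rewrite (maxn_idPr D2max) -ltnNge => /ltnW.
  move: le_D; rewrite (maxn_idPl D23) (maxn_idPr D2max) => le_D.
  (* Mirror image of the previous case: [j] is counted back from [m + k], and [i] is the last spine
     position. *)
  have [j jE] : exists j, j + uphalf k + 1 = m + k by exists (m + k - 1 - uphalf k); lia.
  have [i iE] : exists i, i.+1 = h by exists h.-1; lia.
  have [lt_mj lt_ji] : m < j /\ j < m + k < i by lia.
  apply: (is_diameter_shortcut_floor (x := 2 * i + 2) (y := 2 * j + 2) _ _ le_D); try lia.
  have D2E : D2 = 2 + (i - j) by rewrite /D2; lia.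
  rewrite /shortcut_dist !tree_dist_floor 1?D2E ?leq_min; lia.
have D21 : maxn D2 D3 <= D1 by move: nD2 nD3; clear; lia.
move: le_D; rewrite (maxn_idPl D21) => le_D.
apply: (is_diameter_shortcut_floor (x := 0) (y := 2 * (h - 1) + 2) _ _ le_D);
  rewrite /D1 /shortcut_dist ?tree_dist0_floor ?tree_dist_floor; lia.
Qed.

Lemma diameter_end h m k : k = 2 \/ k = 3 -> (m + k).+1 = h ->
  is_diameter (add_edge (folded (2 * h + 1))
    (edge (2 * h + 1) (2 * m + 2) (2 * (m + k) + 2))) h.
Proof.
move=> k23 mkh.
(* The last floor vertex has become too close to 0, so the one before it, at tree distance [h], is
   used. *)
apply: (is_diameter_shortcut_floor (x := 0) (y := 2 * (m + k - 1) + 2)); try lia.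
  by move=> u v; apply: shortcut_dist_le_end.
by rewrite /shortcut_dist !tree_dist0_floor !tree_dist_floor; lia.
Qed.

Lemma diameter_small h m k : 0 < k < 4 -> m + k < h ->
    ~ ((k = 2 \/ k = 3) /\ (m + k).+1 = h) ->
  is_diameter (add_edge (folded (2 * h + 1))
    (edge (2 * h + 1) (2 * m + 2) (2 * (m + k) + 2)))
    (h + 1).
Proof.
move=> k4 mkh not_end.
apply: (is_diameter_shortcut_floor (x := 0) (y := 2 * (h - 1) + 2)); try lia.
  by move=> u v; apply: shortcut_dist_le_small; lia.
rewrite /shortcut_dist !tree_dist0_floor.
(* If the edge ends at the last floor vertex, then [k = 1] and the route over it has length
   [m + 3 = h + 1]. Otherwise that route has length [h + 4 - k], no shorter than the tree path. *)
have [last_floor|nlast] := eqVneq (m + k).+1 h; last by rewrite !tree_dist_floor; lia.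
have -> : h - 1 = m + k by lia.
by rewrite tree_distxx tree_dist_floor; lia.
Qed.

(* ord(l) = n does not depend on the prime P above 2; it is odd, so every half
   below is exact, and the bounds on m and k make the subtractions genuine. *)
Theorem theorem36 (p : nat) (P : algC -> Prop) (n : nat)
    (p_prime : prime p)
    (p_mod : p = 71 %[mod 120] \/ p = 119 %[mod 120])
    (P_prime : is_prime_ideal p P) (P_above_2 : P 2%:R%R)
    (ord_P : is_class_order p P n)
    (n_gt3 : 3 < n)
    (E : {set 'I_n})
    (E_floor : exists x y : 'I_n,
       [/\ floor_vertex x, floor_vertex y, x != y & E = [set x; y]])
    (m k : nat)
    (m_bounds : 1 <= m <= (n - 3)./2)
    (k_bounds : 1 <= k <= (n - 1)./2 - m)
    (E_def : E = edge n (2 * m) (2 * (m + k))) :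
  [/\ 4 <= k ->
        is_diameter (add_edge (folded n) E)
          (maxn (n + 7 - 2 * k)./2
             (maxn (uphalf k + (n + 5 - 2 * (m + k))./2)
                   (m + uphalf k + 2))),
      (k = 2 \/ k = 3) /\ 2 * (m + k) = n - 1 ->
        is_diameter (add_edge (folded n) E) (n - 1)./2
    & ~ 4 <= k -> ~ ((k = 2 \/ k = 3) /\ 2 * (m + k) = n - 1) ->
        is_diameter (add_edge (folded n) E) (n + 1)./2].
Proof.
have p_mod8 : p %% 8 = 7 by case: p_mod => pE; lia.
have n_odd := class_order_odd p_prime p_mod8 P_prime P_above_2 ord_P.
clear - n_odd m_bounds k_bounds E_def.
have [h nE] : exists h, n = 2 * h + 1 by exists n./2; lia.
subst n; rewrite {}E_def {n_odd}.
(* From here [m] is one less than in the statement: it is the spine position of the first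
   endpoint. *)
case: m m_bounds k_bounds => // m m_bounds k_bounds.
have -> : 2 * m.+1 = 2 * m + 2 by lia.
have -> : 2 * (m.+1 + k) = 2 * (m + k) + 2 by lia.
have mkh : m + k < h by lia.
split.
- move=> k4; have := diameter_large k4 mkh.
  have -> : h + 4 - k = (2 * h + 1 + 7 - 2 * k)./2 by lia.
  have -> : h + 2 - (m + k) = (2 * h + 1 + 5 - (2 * (m + k) + 2))./2 by lia.
  by have -> : m + uphalf k + 3 = m.+1 + uphalf k + 2 by lia.
- case=> k23 mk; have -> : (2 * h + 1 - 1)./2 = h by lia.
  by apply: diameter_end => //; lia.
move=> k4 not_end; have -> : (2 * h + 1 + 1)./2 = h + 1 by lia.
apply: diameter_small => //; first lia.
by case=> k23 mk; apply: not_end; split=> //; lia.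
Qed.
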